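(* For every binary stiffened-gas mixture state (with all quantities as defined in the context), the squared speed of sound $c_s^2$ and the squared Wood speed of sound $c_{sW}^2$ are related by $$\frac{1}{\rho c_s^2}=\frac{1}{\rho c_{sW}^2}+\frac{c_{p1}\alpha_1r_1\,c_{p2}\alpha_2r_2}{\theta\rho c_p}(\zeta_1-\zeta_2)^2,$$ where $c_{sW}^2$ is defined by $$\frac{1}{\rho c_{sW}^2}=\Big\langle\frac{\alpha_k}{r_kc_{sk}^2}\Big\rangle,\qquad c_{sk}^2:=\gamma_k(\gamma_k-1)c_{Vk}\theta,$$ with $\rho c_p=\langle c_{pk}\alpha_kr_k\rangle$ and $$\zeta_k:=\Big(1-\frac{1}{c_{pk}}\partial_\theta\varepsilon_k(\theta,p_k)\Big)\frac{\theta}{p_k}=\frac{1}{c_{pk}r_k},\qquad k=1,2.$$ Consequently, $c_s^2\leq c_{sW}^2$.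
   Context: $\langle\cdot\rangle$ denotes summation over $k=1,2$. Physical constants for $k=1,2$: $c_{Vk}>0$, $\gamma_k>1$, $R_k=(\gamma_k-1)c_{Vk}>0$, $c_{pk}=\gamma_kc_{Vk}$, $p_{*k}\geq 0$, $\varepsilon_{0k}\in\mathbb{R}$. A binary stiffened-gas mixture state consists of component densities $r_k>0$, volume fractions $0<\alpha_k<1$ ($k=1,2$) and a temperature $\theta>0$ such that $\alpha_1+\alpha_2=1$ and the component pressures $p_k=R_kr_k\theta-p_{*k}$ are equal to a common pressure: $p=p_1=p_2>0$. The component specific internal energies are $\varepsilon_k=c_{Vk}\theta+p_{*k}/r_k+\varepsilon_{0k}$; expressing $r_k=(p_k+p_{*k})/(R_k\theta)$, they are also regarded as functions $\varepsilon_k(\theta,p_k)$ of $(\theta,p_k)$, and $\partial_\theta\varepsilon_k(\theta,p_k)$ is the derivative at constant $p_k$. Put $\rho_k=\alpha_kr_k$, $\rho=\langle\rho_k\rangle$, and define $\varepsilon,\varepsilon_0,R,c_V,\gamma$ by $\rho\varepsilon=\langle\rho_k\varepsilon_k\rangle$, $\rho\varepsilon_0=\langle\rho_k\varepsilon_{0k}\rangle$, $\rho R=\langle R_k\rho_k\rangle$, $\rho c_V=\langle c_{Vk}\rho_k\rangle$, $\gamma=R/c_V+1$. Put $\sigma^{(k)}=\dfrac{R_k\rho_k}{c_V\rho}$ and $$b=\langle\sigma^{(k)}(\rho(\varepsilon-\varepsilon_0)-p_{*k})-p_{*k}\rangle,\qquad c=(\sigma^{(1)}p_{*2}+\sigma^{(2)}p_{*1})\rho(\varepsilon-\varepsilon_0)-\gamma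 p_{*1}p_{*2},\qquad d=b^2+4c.$$ It is known that $d>0$ and that the common pressure is $p=p_+:=\tfrac12(b+\sqrt d)$. The squared speed of sound of the mixture is $c_s^2:=\partial_\rho p_++\frac{p_+}{\rho^2}\partial_\varepsilon p_+$, where $b$ and $c$ (hence $p_+$) are regarded as functions of $(\rho,\varepsilon)$ with $\varepsilon_0,\sigma^{(1)},\sigma^{(2)}$ (hence also $\gamma=1+\langle\sigma^{(k)}\rangle$) held constant; equivalently $c_s^2=\dfrac{\gamma(p_++p_{*1})(p_++p_{*2})}{\rho\sqrt d}$. *)

(* Defs.v *)
(* Stdlib reals, with Coquelicot for the partial derivatives. *)
From Stdlib Require Import Reals.
From Coquelicot Require Import Coquelicot.
Open Scope R_scope.

Inductive component : Set := K1 | K2.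

Definition bracket (f : component -> R) : R := f K1 + f K2.

Record stiffened_gas : Type := StiffenedGas {
  cV : R;       (* c_V *)
  gam : R;      (* gamma *)
  pstar : R;    (* p_* *)
  eps0 : R;     (* epsilon_0 *)
  cV_pos : 0 < cV;
  gam_gt1 : 1 < gam;
  pstar_ge0 : 0 <= pstar
}.

Definition gas_R (g : stiffened_gas) : R := (gam g - 1) * cV g.
Definition gas_cp (g : stiffened_gas) : R := gam g * cV g.

Definition gas_pressure (g : stiffened_gas) (theta r : R) : R :=
  gas_R g * r * theta - pstar g.

Definition gas_energy (g : stiffened_gas) (theta r : R) : R :=
  cV g * theta + pstar g / r + eps0 g.

Definition gas_density (g : stiffened_gas) (theta p : R) : R :=
  (p + pstar g) / (gas_R g * theta).

Definition gas_energy_tp (g : stiffened_gas) (theta p : R) : R :=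
  gas_energy g theta (gas_density g theta p).

Definition gas_cs2 (g : stiffened_gas) (theta : R) : R :=
  gam g * (gam g - 1) * cV g * theta.

Record mixture_state (G : component -> stiffened_gas) : Type := MixtureState {
  dens : component -> R;     (* r_k *)
  vfrac : component -> R;    (* alpha_k *)
  temp : R;                  (* theta *)
  dens_pos : forall k, 0 < dens k;
  vfrac_pos : forall k, 0 < vfrac k;
  vfrac_lt1 : forall k, vfrac k < 1;
  temp_pos : 0 < temp;
  vfrac_sum : vfrac K1 + vfrac K2 = 1;
  pressure_eq : gas_pressure (G K1) temp (dens K1)
                = gas_pressure (G K2) temp (dens K2);
  pressure_pos : forall k, 0 < gas_pressure (G k) temp (dens k)
}.

Arguments dens {G}.
Arguments vfrac {G}.
Arguments temp {G}.

Section Mixture.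
Context (G : component -> stiffened_gas) (st : mixture_state G).

Definition pres (k : component) : R := gas_pressure (G k) (temp st) (dens st k).
Definition energy (k : component) : R := gas_energy (G k) (temp st) (dens st k).
Definition pdens (k : component) : R := vfrac st k * dens st k.

Definition mix_rho : R := bracket pdens.
Definition mix_mean (f : component -> R) : R :=
  bracket (fun k => pdens k * f k) / mix_rho.

Definition mix_eps : R := mix_mean energy.
Definition mix_eps0 : R := mix_mean (fun k => eps0 (G k)).
Definition mix_R : R := mix_mean (fun k => gas_R (G k)).
Definition mix_cV : R := mix_mean (fun k => cV (G k)).
Definition mix_cp : R := mix_mean (fun k => gas_cp (G k)).
Definition mix_gam : R := mix_R / mix_cV + 1.

Definition sigma (k : component) : R :=
  gas_R (G k) * pdens k / (mix_cV * mix_rho).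

(* In the next four definitions rho and eps are free variables, while
   mix_eps0, sigma and mix_gam stay frozen at their values in the state st:
   this is the convention under which p_plus is differentiated below. *)
Definition coef_b (rho eps : R) : R :=
  bracket (fun k =>
    sigma k * (rho * (eps - mix_eps0) - pstar (G k)) - pstar (G k)).

Definition coef_c (rho eps : R) : R :=
  (sigma K1 * pstar (G K2) + sigma K2 * pstar (G K1)) * (rho * (eps - mix_eps0))
  - mix_gam * pstar (G K1) * pstar (G K2).

Definition coef_d (rho eps : R) : R := coef_b rho eps ^ 2 + 4 * coef_c rho eps.

Definition p_plus (rho eps : R) : R :=
  / 2 * (coef_b rho eps + sqrt (coef_d rho eps)).

Definition mix_cs2 : R :=
  Derive (fun rho => p_plus rho mix_eps) mix_rho
  + p_plus mix_rho mix_eps / mix_rho ^ 2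
    * Derive (fun eps => p_plus mix_rho eps) mix_eps.

(* The solution of 1 / (rho * c^2) = < alpha_k / (r_k * c_sk^2) > for c^2. *)
Definition wood_cs2 : R :=
  1 / (mix_rho
       * bracket (fun k => vfrac st k / (dens st k * gas_cs2 (G k) (temp st)))).

Definition zeta (k : component) : R :=
  (1 - 1 / gas_cp (G k)
       * Derive (fun theta => gas_energy_tp (G k) theta (pres k)) (temp st))
  * (temp st / pres k).

End Mixture.

Arguments pres {G}.
Arguments energy {G}.
Arguments pdens {G}.
Arguments mix_rho {G}.
Arguments mix_mean {G}.
Arguments mix_eps {G}.
Arguments mix_eps0 {G}.
Arguments mix_R {G}.
Arguments mix_cV {G}.
Arguments mix_cp {G}.
Arguments mix_gam {G}.
Arguments sigma {G}.
Arguments coef_b {G}.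
Arguments coef_c {G}.
Arguments coef_d {G}.
Arguments p_plus {G}.
Arguments mix_cs2 {G}.
Arguments wood_cs2 {G}.
Arguments zeta {G}.

(* Main.v *)
Require Import Defs.
From Stdlib Require Import Reals Lra.
From Coquelicot Require Import Coquelicot.
Open Scope R_scope.

(** Write [q_k = p + p_{*k} = R_k r_k theta], [X = rho (eps - eps_0)] and
    [S = rho c_V].  Summing the internal energies gives
    [X = S theta + <alpha_k p_{*k}>], hence [X + p = gamma S theta]; combined
    with [alpha_1 + alpha_2 = 1] this says
    [(X + p) (sigma_1 q_2 + sigma_2 q_1) = gamma q_1 q_2], which expands to
    the quadratic [p^2 = b p + c] ([pressure_quadratic]).

    The slope of this quadratic at [p] is (lemma [slope_eq])
    [2 p - b = alpha_2 q_1 + alpha_1 q_2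
               + alpha_1 alpha_2 (q_1 - q_2)^2 / (S theta)].
    It is positive, so [p] is the larger root, [sqrt d = 2 p - b], and the
    derivatives of [p_plus] follow by implicit differentiation
    ([is_derive_larger_root]).  They give
    [rho c_s^2 = gamma q_1 q_2 / (2 p - b)] ([rho_cs2_eq]).

    In [1 / (rho c_s^2)] every quantity is now a rational function of
    [r_k], [alpha_k], [theta] and the gas constants, as are the Wood term
    [<alpha_k / (gamma_k q_k)>] and the square of [zeta_1 - zeta_2], where
    [zeta_k = 1 / (c_{pk} r_k)] ([zeta_eq]).  The relation is then an identity
    of rational functions modulo [alpha_1 + alpha_2 = 1], and the inequality
    holds because the extra term is nonnegative. *)

(** * Larger root of a quadratic depending on a parameter *)

Lemma sqrt_discriminant (b c y : R) :
  y ^ 2 = b * y + c -> 0 < 2 * y - b -> sqrt (b ^ 2 + 4 * c) = 2 * y - b.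
Proof.
intros Hy Hs.
replace (b ^ 2 + 4 * c) with ((2 * y - b) ^ 2).
- apply sqrt_pow2; lra.
- replace c with (y ^ 2 - b * y) by lra; ring.
Qed.

(** Implicit differentiation of [y^2 = b y + c]; a positive slope [2 y - b]
    selects the larger root and keeps the discriminant away from zero. *)
Lemma is_derive_larger_root (b c : R -> R) (x b' c' y : R) :
  is_derive b x b' -> is_derive c x c' ->
  y ^ 2 = b x * y + c x -> 0 < 2 * y - b x ->
  is_derive (fun t => / 2 * (b t + sqrt (b t ^ 2 + 4 * c t))) x
            ((b' * y + c') / (2 * y - b x)).
Proof.
intros Hb Hc Hy Hs.
assert (Hsq := sqrt_discriminant _ _ _ Hy Hs).
assert (Hd : 0 < b x ^ 2 + 4 * c x).
{ replace (c x) with (y ^ 2 - b x * y) by lra.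
  replace (b x ^ 2 + 4 * (y ^ 2 - b x * y)) with ((2 * y - b x) ^ 2) by ring.
  now apply pow_lt. }
auto_derive.
- repeat split; trivial; [now exists b' | now exists b' | now exists c'].
- change (fun t : R => b t) with b; change (fun t : R => c t) with c.
  rewrite (is_derive_unique _ _ _ Hb), (is_derive_unique _ _ _ Hc).
  simpl in Hsq |- *; rewrite Hsq; field; lra.
Qed.

(** * A single stiffened gas *)

Lemma gas_R_pos (g : stiffened_gas) : 0 < gas_R g.
Proof.
apply Rmult_lt_0_compat; [pose proof (gam_gt1 g); lra | apply cV_pos].
Qed.

Lemma gas_cp_pos (g : stiffened_gas) : 0 < gas_cp g.
Proof.
apply Rmult_lt_0_compat; [pose proof (gam_gt1 g); lra | apply cV_pos].
Qed.

Lemma gas_cs2_pos (g : stiffened_gas) (theta : R) :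
  0 < theta -> 0 < gas_cs2 g theta.
Proof.
intro Ht; pose proof (gam_gt1 g); pose proof (cV_pos g); unfold gas_cs2.
repeat apply Rmult_lt_0_compat; lra.
Qed.

(** At constant pressure the density is inversely proportional to the
    temperature, so the energy is affine in the temperature. *)
Lemma is_derive_gas_energy_tp (g : stiffened_gas) (theta p : R) :
  0 < theta -> 0 < p ->
  is_derive (fun t : R => gas_energy_tp g t p) theta
            (cV g + pstar g * gas_R g / (p + pstar g)).
Proof.
intros Ht Hp.
pose proof (gas_R_pos g); pose proof (pstar_ge0 g).
unfold gas_energy_tp, gas_energy, gas_density.
auto_derive.
- repeat split; trivial.
  + apply Rmult_integral_contrapositive_currified; lra.
  + apply Rmult_integral_contrapositive_currified; try lra.
    apply Rinv_neq_0_compat, Rmult_integral_contrapositive_currified; lra.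
- field; repeat split; lra.
Qed.

(** * The mixture *)

(** [q_k = p_k + p_{*k}], written through the equation of state. *)
Definition shifted_pres {G : component -> stiffened_gas}
    (st : mixture_state G) (k : component) : R :=
  gas_R (G k) * dens st k * temp st.

(** The volumetric heat capacity [rho c_V]. *)
Definition heat_capacity {G : component -> stiffened_gas}
    (st : mixture_state G) : R :=
  bracket (fun k => pdens st k * cV (G k)).

(** The slope [2 p - b] of the pressure quadratic, in a form which is
    visibly positive; see [slope_eq]. *)
Definition slope {G : component -> stiffened_gas} (st : mixture_state G) : R :=
  vfrac st K2 * shifted_pres st K1 + vfrac st K1 * shifted_pres st K2
  + vfrac st K1 * vfrac st K2 * (shifted_pres st K1 - shifted_pres st K2) ^ 2
    / (heat_capacity st * temp st).

Section MixtureTheory.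
Context (G : component -> stiffened_gas) (st : mixture_state G).

(* [Rsigma.sigma], a finite sum, would capture the short name. *)
Local Notation sigma := Defs.sigma.
Local Notation p := (pres st K1).
Local Notation q := (shifted_pres st).
Local Notation S := (heat_capacity st).
Local Notation X := (mix_rho st * (mix_eps st - mix_eps0 st)).

Lemma pdens_pos k : 0 < pdens st k.
Proof. apply Rmult_lt_0_compat; [apply vfrac_pos | apply dens_pos]. Qed.

Lemma mix_rho_pos : 0 < mix_rho st.
Proof. apply Rplus_lt_0_compat; apply pdens_pos. Qed.

Lemma heat_capacity_pos : 0 < S.
Proof.
apply Rplus_lt_0_compat; apply Rmult_lt_0_compat;
  (apply pdens_pos || apply cV_pos).
Qed.

Lemma shifted_pres_pos k : 0 < q k.
Proof.
apply Rmult_lt_0_compat; [apply Rmult_lt_0_compat |];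
  [apply gas_R_pos | apply dens_pos | apply temp_pos].
Qed.

Lemma pres_K1_eq k : pres st k = p.
Proof. destruct k; [reflexivity | symmetry; apply pressure_eq]. Qed.

Lemma shifted_pres_eq k : q k = p + pstar (G k).
Proof.
rewrite <- (pres_K1_eq k); unfold shifted_pres, pres, gas_pressure; ring.
Qed.

Lemma rho_mean (f : component -> R) :
  mix_rho st * mix_mean st f = bracket (fun k => pdens st k * f k).
Proof. pose proof mix_rho_pos; unfold mix_mean; field; lra. Qed.

Lemma heat_capacity_eq : mix_cV st * mix_rho st = S.
Proof. rewrite Rmult_comm; apply rho_mean. Qed.

(** [R_k rho_k theta = alpha_k q_k]. *)
Lemma sigma_eq k : sigma st k = vfrac st k * q k / (S * temp st).
Proof.
pose proof heat_capacity_pos; pose proof (temp_pos _ st).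
unfold sigma; rewrite heat_capacity_eq; unfold shifted_pres, pdens.
field; lra.
Qed.

Lemma mix_gam_eq : mix_gam st = 1 + sigma st K1 + sigma st K2.
Proof.
pose proof mix_rho_pos; pose proof heat_capacity_pos as HS.
assert (HcV : mix_cV st <> 0).
{ intro E; rewrite <- heat_capacity_eq, E in HS; lra. }
unfold mix_gam, sigma.
replace (mix_R st) with (mix_rho st * mix_R st / mix_rho st) by (field; lra).
unfold mix_R; rewrite rho_mean; unfold bracket; field; lra.
Qed.

Lemma mix_gam_pos : 0 < mix_gam st.
Proof.
assert (Hs : forall k, 0 < sigma st k).
{ intro k; rewrite sigma_eq.
  apply Rdiv_lt_0_compat; apply Rmult_lt_0_compat;
    auto using vfrac_pos, shifted_pres_pos, heat_capacity_pos, temp_pos. }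
pose proof (Hs K1); pose proof (Hs K2); rewrite mix_gam_eq; lra.
Qed.

Lemma rho_cp_eq : mix_rho st * mix_cp st = mix_gam st * S.
Proof.
pose proof heat_capacity_pos.
unfold mix_cp; rewrite rho_mean, mix_gam_eq; unfold sigma.
rewrite heat_capacity_eq.
replace ((1 + gas_R (G K1) * pdens st K1 / S + gas_R (G K2) * pdens st K2 / S) * S)
  with (S + gas_R (G K1) * pdens st K1 + gas_R (G K2) * pdens st K2)
  by (field; lra).
unfold heat_capacity, bracket, gas_cp, gas_R; ring.
Qed.

Lemma thermal_energy_eq :
  X = S * temp st + bracket (fun k => vfrac st k * pstar (G k)).
Proof.
pose proof (dens_pos _ st K1); pose proof (dens_pos _ st K2).
rewrite Rmult_minus_distr_l; unfold mix_eps, mix_eps0; rewrite !rho_mean.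
unfold heat_capacity, bracket, energy, gas_energy, pdens; field; lra.
Qed.

Lemma vfrac_K2_eq : vfrac st K2 = 1 - vfrac st K1.
Proof. pose proof (vfrac_sum _ st); lra. Qed.

(** The mixture enthalpy [X + p] is [S theta + <alpha_k q_k>], because the
    volume fractions add up to one. *)
Lemma enthalpy_eq : X + p = mix_gam st * (S * temp st).
Proof.
pose proof heat_capacity_pos; pose proof (temp_pos _ st).
rewrite thermal_energy_eq, mix_gam_eq, !sigma_eq, !shifted_pres_eq.
unfold bracket; rewrite vfrac_K2_eq; field; lra.
Qed.

Lemma sigma_shifted_pres :
  (sigma st K1 * q K2 + sigma st K2 * q K1) * (S * temp st) = q K1 * q K2.
Proof.
pose proof heat_capacity_pos; pose proof (temp_pos _ st).
rewrite !sigma_eq, vfrac_K2_eq; field; lra.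
Qed.

Lemma pressure_quadratic :
  p ^ 2 = coef_b st (mix_rho st) (mix_eps st) * p
          + coef_c st (mix_rho st) (mix_eps st).
Proof.
assert (E : (X + p) * (sigma st K1 * q K2 + sigma st K2 * q K1)
            = mix_gam st * (q K1 * q K2)).
{ rewrite enthalpy_eq, <- sigma_shifted_pres; ring. }
rewrite !shifted_pres_eq, mix_gam_eq in E.
unfold coef_b, coef_c, bracket; rewrite mix_gam_eq.
(* The claim is [E] expanded in powers of the pressure. *)
lra.
Qed.

(** With [X + p = gamma S theta] and [S theta sigma_k = alpha_k q_k], the
    terms of [2 p - b] still carrying [sigma_k] combine into
    [(q_1 - q_2) (sigma_1 alpha_2 - sigma_2 alpha_1)], and
    [sigma_k = alpha_k q_k / (S theta)] makes this a square. *)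
Lemma slope_eq : 2 * p - coef_b st (mix_rho st) (mix_eps st) = slope st.
Proof.
pose proof heat_capacity_pos; pose proof (temp_pos _ st).
unfold coef_b, slope, bracket.
replace X with (mix_gam st * (S * temp st) - p) by (rewrite <- enthalpy_eq; ring).
rewrite mix_gam_eq, !sigma_eq, !shifted_pres_eq, vfrac_K2_eq; field; lra.
Qed.

Lemma slope_pos : 0 < slope st.
Proof.
pose proof (vfrac_pos _ st K1); pose proof (vfrac_pos _ st K2).
unfold slope; apply Rplus_lt_le_0_compat.
- apply Rplus_lt_0_compat; apply Rmult_lt_0_compat; auto using shifted_pres_pos.
- apply Rle_mult_inv_pos.
  + apply Rmult_le_pos; [apply Rmult_le_pos; lra | apply pow2_ge_0].
  + apply Rmult_lt_0_compat; [apply heat_capacity_pos | apply temp_pos].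
Qed.

Lemma p_plus_eq : p_plus st (mix_rho st) (mix_eps st) = p.
Proof.
unfold p_plus, coef_d.
rewrite (sqrt_discriminant _ _ p); [field | apply pressure_quadratic |].
rewrite slope_eq; apply slope_pos.
Qed.

(** [b] and [c] depend on [rho] and [eps] only through [X], with slopes
    [sigma_1 + sigma_2] and [sigma_1 p_{*2} + sigma_2 p_{*1}].  Hence
    [b' p + c'] is [sigma_1 q_2 + sigma_2 q_1] times the derivative of [X],
    both here and in [is_derive_p_plus_eps]. *)
Lemma is_derive_p_plus_rho :
  is_derive (fun rho : R => p_plus st rho (mix_eps st)) (mix_rho st)
    ((mix_eps st - mix_eps0 st)
     * (sigma st K1 * q K2 + sigma st K2 * q K1) / slope st).
Proof.
rewrite <- slope_eq.
unfold p_plus, coef_d.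
evar_last.
- apply (is_derive_larger_root
           (fun rho => coef_b st rho (mix_eps st))
           (fun rho => coef_c st rho (mix_eps st)) _
           ((sigma st K1 + sigma st K2) * (mix_eps st - mix_eps0 st))
           ((sigma st K1 * pstar (G K2) + sigma st K2 * pstar (G K1))
            * (mix_eps st - mix_eps0 st)) p).
  + unfold coef_b, bracket; auto_derive; trivial; ring.
  + unfold coef_c; auto_derive; trivial; ring.
  + apply pressure_quadratic.
  + rewrite slope_eq; apply slope_pos.
- rewrite !shifted_pres_eq; simpl; unfold Rdiv; ring.
Qed.

Lemma is_derive_p_plus_eps :
  is_derive (fun eps : R => p_plus st (mix_rho st) eps) (mix_eps st)
    (mix_rho st * (sigma st K1 * q K2 + sigma st K2 * q K1) / slope st).
Proof.
rewrite <- slope_eq.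
unfold p_plus, coef_d.
evar_last.
- apply (is_derive_larger_root
           (fun eps => coef_b st (mix_rho st) eps)
           (fun eps => coef_c st (mix_rho st) eps) _
           ((sigma st K1 + sigma st K2) * mix_rho st)
           ((sigma st K1 * pstar (G K2) + sigma st K2 * pstar (G K1))
            * mix_rho st) p).
  + unfold coef_b, bracket; auto_derive; trivial; ring.
  + unfold coef_c; auto_derive; trivial; ring.
  + apply pressure_quadratic.
  + rewrite slope_eq; apply slope_pos.
- rewrite !shifted_pres_eq; simpl; unfold Rdiv; ring.
Qed.

Lemma rho_cs2_eq :
  mix_rho st * mix_cs2 st = mix_gam st * (q K1 * q K2) / slope st.
Proof.
pose proof mix_rho_pos; pose proof slope_pos.
unfold mix_cs2.
rewrite p_plus_eq, (is_derive_unique _ _ _ is_derive_p_plus_rho),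
  (is_derive_unique _ _ _ is_derive_p_plus_eps).
transitivity ((X + p) * (sigma st K1 * q K2 + sigma st K2 * q K1) / slope st).
- field; lra.
- rewrite enthalpy_eq, <- sigma_shifted_pres; field; lra.
Qed.

Lemma mix_cs2_pos : 0 < mix_cs2 st.
Proof.
apply (Rmult_lt_reg_l (mix_rho st)); [apply mix_rho_pos |].
rewrite Rmult_0_r, rho_cs2_eq.
apply Rdiv_lt_0_compat; [| apply slope_pos].
auto using Rmult_lt_0_compat, mix_gam_pos, shifted_pres_pos.
Qed.

Lemma wood_bracket_pos :
  0 < bracket (fun k => vfrac st k / (dens st k * gas_cs2 (G k) (temp st))).
Proof.
apply Rplus_lt_0_compat; apply Rdiv_lt_0_compat; try apply vfrac_pos;
  apply Rmult_lt_0_compat; auto using dens_pos, gas_cs2_pos, temp_pos.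
Qed.

Lemma wood_cs2_pos : 0 < wood_cs2 st.
Proof.
apply Rdiv_lt_0_compat; [lra |].
apply Rmult_lt_0_compat; [apply mix_rho_pos | apply wood_bracket_pos].
Qed.

Lemma inv_rho_wood_cs2 :
  1 / (mix_rho st * wood_cs2 st)
  = bracket (fun k => vfrac st k / (dens st k * gas_cs2 (G k) (temp st))).
Proof.
pose proof mix_rho_pos; pose proof wood_bracket_pos.
unfold wood_cs2; field; lra.
Qed.

Lemma zeta_eq k : zeta st k = 1 / (gas_cp (G k) * dens st k).
Proof.
pose proof (temp_pos _ st); pose proof (dens_pos _ st k).
pose proof (gas_R_pos (G k)); pose proof (gas_cp_pos (G k)).
pose proof (shifted_pres_pos k) as Hq.
assert (Hp : 0 < pres st k) by apply pressure_pos.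
unfold zeta.
rewrite (is_derive_unique _ _ _
           (is_derive_gas_energy_tp (G k) (temp st) (pres st k) (temp_pos _ st) Hp)).
rewrite pres_K1_eq in Hp |- *.
replace (p + pstar (G k)) with (q k) by apply shifted_pres_eq.
(* Mayer's relation [c_p - c_V = R] leaves [zeta_k = R_k theta / (c_{pk} q_k)]. *)
replace (pstar (G k)) with (q k - p) by (rewrite shifted_pres_eq; ring).
replace (cV (G k)) with (gas_cp (G k) - gas_R (G k))
  by (unfold gas_cp, gas_R; ring).
transitivity (gas_R (G k) * temp st / (gas_cp (G k) * q k)).
- field; lra.
- unfold shifted_pres; field; lra.
Qed.

(** Since [gamma S = rho c_p], both sides are rational functions of the
    densities, one volume fraction, the temperature and the gas constants
    [c_{Vk}], [gamma_k], and they agree identically: [p_{*k}] enters only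
    through [q_k = R_k r_k theta], so equality of pressures has been used up. *)
Lemma inv_rho_cs2_eq :
  1 / (mix_rho st * mix_cs2 st)
  = 1 / (mix_rho st * wood_cs2 st)
    + (gas_cp (G K1) * vfrac st K1 * dens st K1
       * (gas_cp (G K2) * vfrac st K2 * dens st K2))
      / (temp st * (mix_rho st * mix_cp st))
      * (zeta st K1 - zeta st K2) ^ 2.
Proof.
pose proof (shifted_pres_pos K1); pose proof (shifted_pres_pos K2).
pose proof mix_gam_pos; pose proof slope_pos.
pose proof heat_capacity_pos as HS.
replace (1 / (mix_rho st * mix_cs2 st))
  with (S * slope st / (mix_gam st * S * (q K1 * q K2)))
  by (rewrite rho_cs2_eq; field; lra).
rewrite inv_rho_wood_cs2, !zeta_eq, <- rho_cp_eq.
assert (HC : 0 < mix_rho st * mix_cp st)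
  by (rewrite rho_cp_eq; now apply Rmult_lt_0_compat).
revert HC HS; unfold mix_cp; rewrite rho_mean.
unfold slope, shifted_pres, heat_capacity, bracket, pdens, gas_cs2, gas_cp, gas_R.
rewrite vfrac_K2_eq.
pose proof (temp_pos _ st).
pose proof (dens_pos _ st K1); pose proof (dens_pos _ st K2).
pose proof (gam_gt1 (G K1)); pose proof (gam_gt1 (G K2)).
pose proof (cV_pos (G K1)); pose proof (cV_pos (G K2)).
intros HC HS; field; repeat split; lra.
Qed.

End MixtureTheory.

Theorem proposition6 (G : component -> stiffened_gas) (st : mixture_state G) :
  1 / (mix_rho st * mix_cs2 st)
    = 1 / (mix_rho st * wood_cs2 st)
      + (gas_cp (G K1) * vfrac st K1 * dens st K1
         * (gas_cp (G K2) * vfrac st K2 * dens st K2))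
        / (temp st * (mix_rho st * mix_cp st))
        * (zeta st K1 - zeta st K2) ^ 2
  /\ (forall k : component, zeta st k = 1 / (gas_cp (G k) * dens st k))
  /\ mix_cs2 st <= wood_cs2 st.
Proof.
pose proof (inv_rho_cs2_eq G st) as E.
split; [exact E | split; [apply zeta_eq |]].
pose proof (mix_rho_pos G st) as Hrho.
pose proof (mix_cs2_pos G st) as Hc; pose proof (wood_cs2_pos G st) as Hw.
apply (Rmult_le_reg_l (mix_rho st)); [exact Hrho |].
rewrite <- (Rinv_inv (mix_rho st * mix_cs2 st)),
  <- (Rinv_inv (mix_rho st * wood_cs2 st)).
apply Rinv_le_contravar.
- now apply Rinv_0_lt_compat, Rmult_lt_0_compat.
- unfold Rdiv in E; rewrite !Rmult_1_l in E; rewrite E.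
  match goal with |- ?a <= ?a + ?b => enough (0 <= b) by lra end.
  pose proof (gas_cp_pos (G K1)); pose proof (gas_cp_pos (G K2)).
  apply Rmult_le_pos; [| apply pow2_ge_0].
  apply Rlt_le, Rdiv_lt_0_compat.
  + auto 6 using Rmult_lt_0_compat, vfrac_pos, dens_pos.
  + rewrite rho_cp_eq.
    auto using Rmult_lt_0_compat, temp_pos, mix_gam_pos, heat_capacity_pos.
Qed.
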